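(* Let $K\ge2$, and let $v_T$ be the value function of the partially observed game described in the context. For every distribution $m\in\mathcal P(\mathbb R^K)$, every $T\in\mathbb N$ and every $t\in\{0,1,\dots,T-1\}$, $$v_T(t,m)=\inf_{b\in\mathcal P([K])}\ \sup_{a\in\mathcal P(\{0,1\}^K)}\left(\sum_{i=1}^K b(i)\,\hat a(i)\,v_T\big(t+1,l(m,a,i)\big)+\sum_{i=1}^K b(i)\,\hat a(-i)\,v_T\big(t+1,l(m,a,-i)\big)\right),$$ where $b(i)\hat a(i)$ and $b(i)\hat a(-i)$ are the probabilities of receiving the signal $i$ and $-i$ respectively, and $l(m,a,\pm i)$ is the update of beliefs.
   Context: Notation: $[K]=\{1,\dots,K\}$; $\mathcal P(E)$ is the set of probability measures on $E$; elements of $\{0,1\}^K$ are identified with subsets $j\subset[K]$, $j^c=[K]\setminus j$. $e_1,\dots,e_K$ is the canonical basis of $\mathbb R^K$, $e_j=\sum_{i\in j}e_i$, $e=\sum_{i=1}^Ke_i$. For a finite measure $\mu$ and $v\in\mathbb R^K$, $\mu_{\sharp v}$ is the translate: $\int f\,d\mu_{\sharp v}=\int f(x+v)\,\mu(dx)$. For $a\in\mathcal P(\{0,1\}^K)$, $\hat a(i)=\sum_{j:i\in j}a(j)$ and $\hat a(-i)=\sum_{j:i\notin j}a(j)$. The belief update is $$l(m,a,i)=\sum_{j:i\in j}\Big(\tfrac{a(j)}{\hat a(i)}m\Big)_{\sharp -e_{j^c}},\qquad l(m,a,-i)=\sum_{j:i\notin j}\Big(\tfrac{a(j)}{\hat a(-i)}m\Big)_{\sharp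 e_j},$$ with the convention $l(m,a,y)=\delta_{\mathbf 0}$ if $\hat a(y)=0$; it is the conditional law of the next state given the signal $y$ when the current state has law $m$ and the adversary plays $a$. Game $\Gamma_T(t,m)$: it starts at time $t$ with $X_t\sim m$ in $\mathbb R^K$ and is played at rounds $s=t,\dots,T-1$. At round $s$ the forecaster picks $b_s\in\mathcal P([K])$ and, independently, the adversary picks $a_s\in\mathcal P(\{0,1\}^K)$; then $I_s\sim b_s$ and $J_s\sim a_s$ are drawn independently. The state evolves by $X_{s+1}=X_s+e_{J_s}-\mathbf 1_{\{I_s\in J_s\}}e$, and the signal is $Y_s=I_s$ if $I_s\in J_s$, $Y_s=-I_s$ otherwise. Before round $s$ both players know the history $h_s=(m,a_t,y_t,\dots,a_{s-1},y_{s-1})$ (initial law, the adversary's past mixed actions, and past signals); the state is not observed. A strategy $\alpha=(\alpha_s)_{s}$ of the adversary consists of measurable maps $h_s\mapsto\alpha_s(h_s)\in\mathcal P(\{0,1\}^K)$, and a strategy $\beta=(\beta_s)_s$ of the forecaster consists of measurable maps $h_s\mapsto\beta_s(h_s)\in\mathcal P([K])$; $\mathcal A$, $\mathcal B$ are the sets of all such strategies. Define $$\gamma_T(t,m,\alpha,\beta)=\mathbb E^{m,\alpha,\beta}\big[\max_i X_T^i\,\big|\,X_t\sim m\big],\qquad v_T(t,m)=\inf_{\beta\in\mathcal B}\sup_{\alpha\in\mathcal A}\gamma_T(t,m,\alpha,\beta),$$ so $v_T(T,m)=\int\max_i x^i\,m(dx)$. *)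

(* Defs.v *)
From HB Require Import structures.
From mathcomp Require Import all_boot all_order all_algebra.
From mathcomp Require Import all_classical all_reals all_analysis.

Set Implicit Arguments.
Unset Strict Implicit.
Unset Printing Implicit Defensive.
Import Order.TTheory GRing.Theory Num.Theory.
Import numFieldNormedType.Exports.

Local Open Scope classical_set_scope.
Local Open Scope ring_scope.

(* Throughout, K is written n.+1: a measurableType is pointed, so the finite
   set [K] must be visibly nonempty. Finite sets carry the discrete
   sigma-algebra and R^K = 'rV[R]_n.+1 carries its Borel sigma-algebra. *)

HB.instance Definition _ n := isPointed.Build 'I_n.+1 ord0.
HB.instance Definition _ n :=
  @isMeasurable.Build default_measure_display 'I_n.+1
    discrete_measurable discrete_measurable0
    discrete_measurableC discrete_measurableU.

HB.instance Definition _ (T : finType) := isPointed.Build {set T} finset.set0.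
HB.instance Definition _ (T : finType) :=
  @isMeasurable.Build default_measure_display {set T}
    discrete_measurable discrete_measurable0
    discrete_measurableC discrete_measurableU.

HB.instance Definition _ (R : realType) (p q : nat) :=
  Measurable.copy 'M[R]_(p, q) (g_sigma_algebraType (@open 'M[R]_(p, q))).

(* pprobability E R is P(E), with the sigma-algebra generated by the
   evaluations mu |-> mu U; for E = R^K this is the Borel sigma-algebra of the
   weak topology, for finite E that of the simplex. *)
Notation law R n := (pprobability 'rV[R]_n.+1 R).
Notation mixed_expert R n := (pprobability 'I_n.+1 R).
Notation mixed_gains R n := (pprobability {set 'I_n.+1} R).

Section Game.
Variables (R : realType) (n : nat).

Definition mass d (E : measurableType d) (p : pprobability E R) (x : E) : R :=
  fine ((p : probability E R) [set x]%classic).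

Definition indic_vec (j : {set 'I_n.+1}) : 'rV[R]_n.+1 :=
  \row_i (i \in j)%:R.

Definition max_coord (x : 'rV[R]_n.+1) : R :=
  \big[Num.max/x ord0 ord0]_(i < n.+1) x ord0 i.

(* The signal +i is (i, true) and the signal -i is (i, false). *)
Definition signal := ('I_n.+1 * bool)%type.

(* A draw is the pair (I_s, J_s). *)
Definition draw := ('I_n.+1 * {set 'I_n.+1})%type.

Definition signal_of (w : draw) : signal := (w.1, w.1 \in w.2).

Definition next_state (x : 'rV[R]_n.+1) (w : draw) : 'rV[R]_n.+1 :=
  x + indic_vec w.2 - (w.1 \in w.2)%:R *: indic_vec [set: 'I_n.+1]%SET.

Definition compatible (y : signal) (j : {set 'I_n.+1}) : bool :=
  (y.1 \in j) == y.2.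

Definition hat (a : mixed_gains R n) (y : signal) : R :=
  \sum_(j | compatible y j) mass a j.

Definition signal_shift (y : signal) (j : {set 'I_n.+1}) : 'rV[R]_n.+1 :=
  if y.2 then - indic_vec (~: j)%SET else indic_vec j.

Definition translate (mu : set 'rV[R]_n.+1 -> \bar R) (v : 'rV[R]_n.+1) :
    set 'rV[R]_n.+1 -> \bar R :=
  pushforward mu (fun x : 'rV[R]_n.+1 => x + v).

Definition belief_update (m : law R n) (a : mixed_gains R n) (y : signal) :
    set 'rV[R]_n.+1 -> \bar R :=
  if hat a y == 0 then \d_(0 : 'rV[R]_n.+1) else fun A =>
    (\sum_(j | compatible y j)
       (mass a j / hat a y)%:E * translate (m : probability _ R) (signal_shift y j) A)%E.

Lemma mass_ge0 d (E : measurableType d) (p : pprobability E R) (x : E) :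
  0 <= mass p x.
Proof. exact/fine_ge0/measure_ge0. Qed.

Lemma measurable_translation (v : 'rV[R]_n.+1) :
  measurable_fun [set: 'rV[R]_n.+1] (fun x : 'rV[R]_n.+1 => x + v).
Proof.
apply: (@measurability _ _ _ _ _ _ (@open 'rV[R]_n.+1)) => // _ [A oA <-].
rewrite setTI; apply: sub_sigma_algebra.
have cv : continuous (fun x : 'rV[R]_n.+1 => x + v).
  move=> x; apply: (@continuousD _ 'rV[R]_n.+1 'rV[R]_n.+1 id (cst v)).
    by move=> B; apply.
  exact: cst_continuous.
by move/continuousP : cv; exact.
Qed.

Section belief_update_probability.
Variables (m : law R n) (a : mixed_gains R n) (y : signal).

Let measurable_shifted v (A : set 'rV[R]_n.+1) : measurable A ->
  measurable ((fun x : 'rV[R]_n.+1 => x + v) @^-1` A).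
Proof. by move=> mA; rewrite -[X in measurable X]setTI; exact: measurable_translation. Qed.

Let hat_ge0 : 0 <= hat a y.
Proof. by apply: sumr_ge0 => j _; exact: mass_ge0. Qed.

Let weight_ge0 j : (0 <= (mass a j / hat a y)%:E)%E.
Proof. by rewrite lee_fin divr_ge0// mass_ge0. Qed.

Let update0 : belief_update m a y set0 = 0%E.
Proof.
rewrite /belief_update; case: ifP => _; first exact: measure0.
by rewrite big1// => j _; rewrite /translate /pushforward preimage_set0 measure0 mule0.
Qed.

Let update_ge0 A : (0 <= belief_update m a y A)%E.
Proof.
rewrite /belief_update; case: ifP => _; first exact: measure_ge0.
by apply: sume_ge0 => j _; apply: mule_ge0; [exact: weight_ge0|exact: (measure_ge0 (m : probability _ R))].
Qed.

Let update_sigma_additive : semi_sigma_additive (belief_update m a y).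
Proof.
rewrite /belief_update; case: ifP => _.
  exact: measure_semi_sigma_additive.
move=> F mF tF mUF.
under eq_fun do rewrite exchange_big/=.
apply: cvg_nnesum => j _.
  by near=> k; apply: sume_ge0 => i _; apply: mule_ge0; [exact: weight_ge0|exact: (measure_ge0 (m : probability _ R))].
under eq_fun.
  move=> k; rewrite -ge0_sume_distrr; last by move=> i _; exact: (measure_ge0 (m : probability _ R)).
  over.
apply: cvgeZl => //; rewrite /translate /pushforward preimage_bigcup.
apply: measure_semi_sigma_additive.
- by move=> i; exact: measurable_shifted.
- apply/trivIsetP => /= i k _ _ ik; rewrite -preimage_setI.
  by move/trivIsetP : tF => /(_ _ _ _ _ ik) ->//; rewrite preimage_set0.
- by rewrite -preimage_bigcup; exact: measurable_shifted.
Unshelve. all: by end_near. Qed.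

HB.instance Definition _ := isMeasure.Build _ _ _ (belief_update m a y)
  update0 update_ge0 update_sigma_additive.

Let update_setT : belief_update m a y setT = 1%E.
Proof.
rewrite /belief_update; case: ifPn => [_|hat0]; first exact: probability_setT.
under eq_bigr do rewrite /translate /pushforward preimage_setT probability_setT mule1.
by rewrite sumEFin -mulr_suml divff.
Qed.

HB.instance Definition _ :=
  Measure_isProbability.Build _ _ _ (belief_update m a y) update_setT.

End belief_update_probability.

(* history k is the type of h_s for s = t + k. *)
Notation history k :=
  (law R n * k.-tuple (mixed_gains R n * ('I_n.+1 * bool)))%type.

(* Strategies of Gamma_T(t, .), with N = T - t rounds k = 0, ..., N.-1. *)
Definition forecaster_strategy (N : nat) :=
  forall k : 'I_N, {mfun history k >-> mixed_expert R n}.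

Definition adversary_strategy (N : nat) :=
  forall k : 'I_N, {mfun history k >-> mixed_gains R n}.

Section Play.
Variables (N : nat) (m : law R n).
Variables (alpha : adversary_strategy N) (beta : forecaster_strategy N).
Variable w : N.-tuple draw.

(* The first k stages (a_s, y_s) when alpha is played and the draws are w. *)
Fixpoint past (k : nat) : (k <= N)%N -> k.-tuple (mixed_gains R n * signal) :=
  match k with
  | 0 => fun _ => [tuple]
  | k'.+1 => fun ltkN =>
      let h := past (ltnW ltkN) in
      [tuple of rcons h (alpha (Ordinal ltkN) (m, h),
                         signal_of (tnth w (Ordinal ltkN)))]
  end.

Definition history_at (k : 'I_N) : history k := (m, past (ltnW (ltn_ord k))).

Definition draws_prob : R :=
  \prod_(k < N) (mass (beta k (history_at k)) (tnth w k).1 *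
                 mass (alpha k (history_at k)) (tnth w k).2).

End Play.

Definition final_state (N : nat) (x : 'rV[R]_n.+1) (w : N.-tuple draw) :
  'rV[R]_n.+1 := foldl next_state x w.

Local Open Scope ereal_scope.

(* Strategies do not observe the state, so under P^{m, alpha, beta} the initial
   state (of law m) is independent of the draws (of law draws_prob).
   When max_coord is not m-integrable the value is infinite, following the
   convention +oo - oo = -oo of the integral. *)
Definition payoff (T t : nat) (m : law R n)
    (alpha : adversary_strategy (T - t))
    (beta : forecaster_strategy (T - t)) : \bar R :=
  \int[(m : probability _ R)]_x
    (\sum_(w : (T - t).-tuple draw)
       draws_prob m alpha beta w * max_coord (final_state x w))%R%:E.

Definition game_value (T t : nat) (m : law R n) : \bar R :=
  ereal_inf (range (fun beta : forecaster_strategy (T - t) =>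
    ereal_sup (range (fun alpha : adversary_strategy (T - t) =>
      payoff m alpha beta)))).

End Game.

(* Main.v *)
From HB Require Import structures.
Require Import Defs.
From mathcomp Require Import all_boot all_order all_algebra.
From mathcomp Require Import all_classical all_reals all_analysis.
From mathcomp Require Import measurable_realfun lra.
Import Order.TTheory GRing.Theory Num.Theory.
Import numFieldNormedType.Exports.
Local Open Scope classical_set_scope.
Local Open Scope ereal_scope.
Set Implicit Arguments.
Unset Strict Implicit.
Unset Printing Implicit Defensive.

(* Strategies do not see the state, so when max_coord is m-integrable the payoff
   is the expectation, over the draws w alone, of the mean final maximum
   F w = E[max_coord (final_state X w)]. This is a game with public histories
   and a bounded payoff F; after a first stage (a, y) it continues as the game
   with payoff (after F a y), which is hat a y times the payoff of the game
   started at the updated belief. The one-stage formula is proved for the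
   abstract game with two one-sided arguments: the adversary's continuation only
   has to depend on the finitely many signals, and the forecaster's continuation
   on the signal and on the cell of a fine grid that contains the observed a.
   When max_coord is not m-integrable, every payoff equals the infinite integral
   of max_coord against m, and so does the integral against each updated belief
   that has positive probability. *)

(** * Measurable case distinctions with countably many cases *)

(** A preimage is the countable union of its traces on the pieces [c = i]. This makes a strategy
    chosen by a countable-valued observation measurable. *)
Lemma measurable_countable_case d d' (T : measurableType d)
    (U : measurableType d') (I : countType) (c : T -> I) (f : I -> T -> U) :
  (forall i, measurable (c @^-1` [set i])) ->
  (forall i, measurable_fun [set: T] (f i)) ->
  measurable_fun [set: T] (fun x => f (c x) x).
Proof.
move=> mc mf _ B mB; rewrite setTI.
rewrite (_ : _ @^-1` B = \bigcup_i (c @^-1` [set i] `&` f i @^-1` B));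
  last by apply/seteqP; split=> [x fB|x [i _ [/= <-]]//]; exists (c x).
apply: countable_bigcupT_measurable => // i; apply: measurableI => //.
by rewrite -[X in measurable X]setTI; exact: mf.
Qed.

Definition mfun_of d d' (T : measurableType d) (U : measurableType d')
    (f : T -> U) (mf : measurable_fun [set: T] f) : {mfun T >-> U} :=
  HB.pack f (isMeasurableFun.Build _ _ _ _ f mf).

(** * Splitting a strategy after its first stage, and gluing it back *)

Section Strategies.
Variables (R : realType) (n : nat).
Local Notation stage := (mixed_gains R n * signal n)%type.

Local Notation history k := (law R n * k.-tuple stage)%type.

(** Covers both players, so that each operation on strategies is defined once. *)
Definition strategy d (E : measurableType d) (N : nat) :=
  forall k : 'I_N, {mfun history k >-> E}.

Section Continuation.
Context d (E : measurableType d) (N : nat).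

Lemma measurable_continuation (s : strategy E N.+1) (m : law R n) (x : stage)
    (k : 'I_N) :
  measurable_fun [set: history k]
    (fun h => s (lift ord0 k) (m, [tuple of x :: h.2])).
Proof.
apply: (measurableT_comp (f := s (lift ord0 k))) => //.
apply: measurable_fun_pair => //.
exact: measurable_cons.
Qed.

(** The law in the shortened history is ignored and replaced by [m], because every history of the
    original game starts with its initial law. *)
Definition continuation (s : strategy E N.+1) (m : law R n) (x : stage) :
    strategy E N :=
  fun k => mfun_of (measurable_continuation s m x (k := k)).

Variables (I : countType) (c : stage -> I).
Hypothesis measurable_c : forall i, measurable (c @^-1` [set i]).
Variables (e : E) (mu : I -> law R n) (s : I -> strategy E N).

Lemma measurable_join (k : 'I_N) :
  measurable_fun [set: law R n * k.+1.-tuple stage]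
    (fun h => s (c (thead h.2)) k (mu (c (thead h.2)), [tuple of behead h.2])).
Proof.
apply: (@measurable_countable_case _ _ _ _ I
  (fun h : law R n * k.+1.-tuple stage => c (thead h.2))
  (fun i h => s i k (mu i, [tuple of behead h.2]))) => i.
  rewrite -[X in measurable X]setTI.
  have mt : measurable_fun [set: law R n * k.+1.-tuple stage]
      (fun h => thead h.2).
    by apply: (measurableT_comp (measurable_tnth ord0)).
  exact: (mt _ _ (measurable_c i)).
apply: (measurableT_comp (f := s i k)) => //.
apply: measurable_fun_pair => //.
by apply: (measurableT_comp (@measurable_behead _ _ _)).
Qed.

(** Plays [e] first, then for good the strategy selected by the class [c] of the first stage, run on
    the remaining stages as if started from [mu]. The match on [k] makes the type of nonempty
    histories compute. *)
Definition join_strategy : strategy E N.+1 :=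
  fun k => match k return {mfun history k >-> E} with
  | Ordinal 0 _ => mfun_of (measurable_cst e)
  | Ordinal k'.+1 p => 
      mfun_of (measurable_join (k := Ordinal (p : (k' < N)%N)))
  end.

Lemma continuation_join (m m' : law R n) (x : stage) (k : 'I_N) h :
  continuation join_strategy m x k (m', h) = s (c x) k (mu (c x), h).
Proof.
rewrite /=.
case: k h => k p h /=.
rewrite (theadE x h).
(* Both sides now differ only in the proofs carried by the ordinal and the tuple. *)
apply: (f_equal2 (fun (q : (k < N)%N) (g : k.-tuple stage) =>
  s (c x) (Ordinal q) (mu (c x), g)) (bool_irrelevance _ _)).
exact: val_inj.
Qed.

End Continuation.

End Strategies.

(** * Finite sums over draws, signals and masses *)

Lemma sum_tuple_cons (V : nmodType) (D : finType) N (F : N.+1.-tuple D -> V) :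
  (\sum_w F w = \sum_(x : D) \sum_(w : N.-tuple D) F [tuple of x :: w])%R.
Proof.
rewrite (pair_bigA _ (fun (x : D) (w : N.-tuple D) => F [tuple of x :: w])) /=.
rewrite (reindex (fun p : D * N.-tuple D => [tuple of p.1 :: p.2])) //=.
exists (fun w => (thead w, [tuple of behead w])) => [[x w] _|w _] /=.
  by congr pair; apply: val_inj.
by apply: val_inj => /=; case/tupleP: w => x w.
Qed.

Lemma sum_pair (V : nmodType) (A B : finType) (F : A * B -> V) :
  (\sum_p F p = \sum_i \sum_j F (i, j))%R.
Proof.
by rewrite (pair_bigA _ (fun i j => F (i, j))); apply: eq_bigr => -[].
Qed.

Lemma sum_mass d (R : realType) (E : measurableType d) (l : seq E)
    (p : pprobability E R) :
  (forall x : E, measurable [set x]) -> uniq l -> (forall x, x \in l) ->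
  (\sum_(x <- l) mass p x = 1)%R.
Proof.
move=> mE ul al; apply/EFin_inj; rewrite -sumEFin.
rewrite -(probability_setT (p : probability E R)).
rewrite (_ : [set: E] = \bigcup_(x in [set` l]) [set x]); last first.
  by apply/seteqP; split => // x _; exists x => //=; exact: al.
rewrite measure_fin_bigcup //; [|exact: finite_seq|by move=> x y _ _ [z [/= -> ->]]].
rewrite -fsbig_seq //; apply: eq_bigr => x _.
by rewrite /mass fineK // fin_num_measure.
Qed.

(** * The law of the draws and its decomposition at the first stage *)

Section Expectation.
Variables (R : realType) (n : nat).
Local Notation stage := (mixed_gains R n * signal n)%type.
Local Notation history k := (law R n * k.-tuple stage)%type.

Lemma sum_mass_expert (b : mixed_expert R n) : (\sum_i mass b i = 1)%R.
Proof.
by apply: sum_mass => // [|x]; [exact: index_enum_uniq|exact: mem_index_enum].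
Qed.

Lemma sum_mass_gains (a : mixed_gains R n) : (\sum_j mass a j = 1)%R.
Proof.
by apply: sum_mass => // [|x]; [exact: index_enum_uniq|exact: mem_index_enum].
Qed.

Lemma pastS N (m : law R n) (alpha : adversary_strategy R n N) w k
    (lt : (k < N)%N) :
  past m alpha w lt = [tuple of rcons (past m alpha w (ltnW lt))
    (alpha (Ordinal lt) (m, past m alpha w (ltnW lt)),
     signal_of (tnth w (Ordinal lt)))].
Proof. by []. Qed.

Section Cons.
Variables (N : nat) (m m' : law R n).
Variables (alpha : adversary_strategy R n N.+1).
Variables (beta : forecaster_strategy R n N.+1).
Variables (w0 : draw n) (w : N.-tuple (draw n)).

Let a := alpha ord0 (m, [tuple]).
Let x : stage := (a, signal_of w0).
Let alpha' : adversary_strategy R n N := continuation alpha m x.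

(** The law [m'] can be arbitrary since [continuation] puts [m] in its place. *)
Lemma past_cons k (lek : (k <= N)%N) (lek1 : (k.+1 <= N.+1)%N) :
  past m alpha [tuple of w0 :: w] lek1 = [tuple of x :: past m' alpha' w lek].
Proof.
elim: k lek lek1 => [|k IH] lek lek1.
  apply: val_inj => /=; rewrite /x /a.
  by rewrite (bool_irrelevance lek1 (ltn0Sn N)).
rewrite (pastS m alpha) (pastS m' alpha') (IH (ltnW lek)).
apply: val_inj => /=; congr (_ :: rcons _ (_, _)).
  exact: (f_equal (fun q : (k.+1 < N.+1)%N =>
    alpha (Ordinal q) (m, [tuple of x :: past m' alpha' w (ltnW lek)]))
    (bool_irrelevance _ _)).
rewrite -[in RHS](tnthS w0 w) /=; congr (signal_of (tnth _ _)).
exact: val_inj.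
Qed.

Lemma draws_prob_cons :
  (draws_prob m alpha beta [tuple of w0 :: w] =
   mass (beta ord0 (m, [tuple])) w0.1 * mass a w0.2 *
   draws_prob m' alpha' (continuation beta m x) w)%R.
Proof.
rewrite /draws_prob big_ord_recl; congr (_ * _)%R.
apply: eq_bigr => k _; rewrite (tnthS w0 w k).
have -> : history_at m alpha [tuple of w0 :: w] (lift ord0 k) =
    (m, [tuple of x :: past m' alpha' w (ltnW (ltn_ord k))]).
  congr pair; exact: past_cons.
by [].
Qed.

End Cons.

(** By induction on the stage both plays pass through the same stages, so only the values of the
    strategies at the actual initial laws matter. *)
Lemma draws_prob_ext N (m m' : law R n)
    (alpha alpha' : adversary_strategy R n N)
    (beta beta' : forecaster_strategy R n N) w :
  (forall k h, alpha k (m, h) = alpha' k (m', h)) ->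
  (forall k h, beta k (m, h) = beta' k (m', h)) ->
  draws_prob m alpha beta w = draws_prob m' alpha' beta' w.
Proof.
move=> ea eb.
have ep k (le : (k <= N)%N) : past m alpha w le = past m' alpha' w le.
  by elim: k le => // k IH le; rewrite !pastS IH ea.
by apply: eq_bigr => k _; rewrite /history_at ep ea eb.
Qed.

Definition expected N (m : law R n) (alpha : adversary_strategy R n N)
    (beta : forecaster_strategy R n N) (F : N.-tuple (draw n) -> R) : R :=
  (\sum_w draws_prob m alpha beta w * F w)%R.

(* The payoff after a first stage (a, y), multiplied by hat a y: without the
   normalisation it is Lipschitz in a, also where hat a y vanishes. *)
Definition after N (F : N.+1.-tuple (draw n) -> R) (a : mixed_gains R n)
    (y : signal n) (w : N.-tuple (draw n)) : R :=
  (\sum_(j | compatible y j) mass a j * F [tuple of (y.1, j) :: w])%R.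

(** Draws with the same signal have the same continuation, so the sum over the subsets compatible
    with a signal moves inside, into [after]. The masses of [a] go with it and only those of the
    forecaster stay in front. *)
Lemma expectedS N (m : law R n) (m' : signal n -> law R n)
    (alpha : adversary_strategy R n N.+1)
    (beta : forecaster_strategy R n N.+1) (F : N.+1.-tuple (draw n) -> R) :
  let a := alpha ord0 (m, [tuple]) in
  (expected m alpha beta F =
   \sum_(y : signal n) mass (beta ord0 (m, [tuple])) y.1 *
     expected (m' y) (continuation alpha m (a, y)) (continuation beta m (a, y))
       (after F a y))%R.
Proof.
move=> a; rewrite /expected sum_tuple_cons !sum_pair.
apply: eq_bigr => i _.
rewrite (partition_big (fun j : {set 'I_n.+1} => i \in j) xpredT) //=.
apply: eq_bigr => b _; rewrite big_distrr /= exchange_big /=.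
apply: eq_bigr => w _; rewrite /after !big_distrr /=.
apply: eq_bigr => j /eqP ib.
rewrite (draws_prob_cons m (m' (i, b))) /signal_of /= ib -/a.
by rewrite !mulrA; congr (_ * _)%R; rewrite -!mulrA [(mass a j * _)%R]mulrC.
Qed.

Lemma expected_ext N (m m' : law R n) (alpha alpha' : adversary_strategy R n N)
    (beta beta' : forecaster_strategy R n N) F :
  (forall k h, alpha k (m, h) = alpha' k (m', h)) ->
  (forall k h, beta k (m, h) = beta' k (m', h)) ->
  expected m alpha beta F = expected m' alpha' beta' F.
Proof.
by move=> ea eb; apply: eq_bigr => w _; rewrite (draws_prob_ext _ ea eb).
Qed.

Lemma draws_prob_ge0 N (m : law R n) (alpha : adversary_strategy R n N)
    (beta : forecaster_strategy R n N) w : (0 <= draws_prob m alpha beta w)%R.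
Proof. by apply: prodr_ge0 => k _; rewrite mulr_ge0 // mass_ge0. Qed.

(** For each [i] the two signals split the subsets according to whether they contain [i]. *)
Lemma sum_compatible (V : nmodType) (f : 'I_n.+1 -> {set 'I_n.+1} -> V) :
  (\sum_(y : signal n) \sum_(j | compatible y j) f y.1 j =
   \sum_i \sum_j f i j)%R.
Proof.
rewrite sum_pair.
apply: eq_bigr => i _.
by rewrite [RHS](partition_big (fun j : {set 'I_n.+1} => i \in j) xpredT).
Qed.

Lemma hat_ge0 (a : mixed_gains R n) (y : signal n) : (0 <= hat a y)%R.
Proof. by apply: sumr_ge0 => j _; exact: mass_ge0. Qed.

Lemma sum_hat (b : mixed_expert R n) (a : mixed_gains R n) :
  (\sum_(y : signal n) mass b y.1 * hat a y = 1)%R.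
Proof.
under eq_bigr do rewrite /hat big_distrr /=.
rewrite (sum_compatible (fun i j => mass b i * mass a j)%R).
rewrite -(sum_mass_expert b).
by apply: eq_bigr => i _; rewrite -big_distrr /= sum_mass_gains mulr1.
Qed.

(** Each expert occurs with both signs. Hence an error [e / 2] per signal adds up to [e] in the
    estimates below. *)
Lemma sum_signal_mass (b : mixed_expert R n) :
  (\sum_(y : signal n) mass b y.1 = 2)%R.
Proof.
rewrite sum_pair.
under eq_bigr do rewrite big_bool /=.
by rewrite big_split /= sum_mass_expert.
Qed.

(** Induction through [expectedS] with payoff 1, for which [after] is constantly [hat a y]. *)
Lemma sum_draws_prob N (m : law R n) (alpha : adversary_strategy R n N)
    (beta : forecaster_strategy R n N) :
  (\sum_w draws_prob m alpha beta w = 1)%R.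
Proof.
elim: N m alpha beta => [|N IH] m alpha beta.
  rewrite (big_pred1 [tuple]) /=; first by rewrite /draws_prob big_ord0.
  by move=> w; apply/esym/eqP; exact: tuple0.
transitivity (expected m alpha beta (fun=> 1%R)).
  by apply: eq_bigr => w _; rewrite mulr1.
rewrite (expectedS m (fun=> m)).
rewrite -[RHS](sum_hat (beta ord0 (m, [tuple])) (alpha ord0 (m, [tuple]))).
apply: eq_bigr => y _; congr (_ * _)%R.
rewrite /expected /after; under eq_bigr do under eq_bigr do rewrite mulr1.
by rewrite -big_distrl /= IH mul1r.
Qed.

Lemma expected_le N (m : law R n) (alpha : adversary_strategy R n N)
    (beta : forecaster_strategy R n N) F G (e : R) :
  (forall w, F w <= G w + e)%R ->
  (expected m alpha beta F <= expected m alpha beta G + e)%R.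
Proof.
move=> FG; rewrite -[X in (_ <= _ + X)%R]mul1r -(sum_draws_prob m alpha beta).
rewrite big_distrl /= -big_split /=; apply: ler_sum => w _.
by rewrite -mulrDr ler_wpM2l // draws_prob_ge0.
Qed.

Lemma expectedZ N (m : law R n) (alpha : adversary_strategy R n N)
    (beta : forecaster_strategy R n N) F (c : R) :
  (expected m alpha beta (fun w => c * F w) = c * expected m alpha beta F)%R.
Proof. by rewrite big_distrr /=; apply: eq_bigr => w _; rewrite mulrCA. Qed.

End Expectation.

(** * Calculus of inf-sup values *)

Definition infsup (R : realType) (B A : Type) (f : B -> A -> \bar R) : \bar R :=
  ereal_inf (range (fun b => ereal_sup (range (f b)))).

Lemma infsup_lbound (R : realType) (B A : Type) (f : B -> A -> \bar R) b :
  infsup f <= ereal_sup (range (f b)).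
Proof. by apply: ereal_inf_lbound; exists b. Qed.

Lemma le_infsup (R : realType) (B A B' A' : Type) (f : B -> A -> \bar R)
    (g : B' -> A' -> \bar R) :
  (forall b', exists b, forall a, exists a', f b a <= g b' a') ->
  infsup f <= infsup g.
Proof.
move=> fg; apply: le_ereal_inf_tmp => _ [b' _ <-]; have [b fgb] := fg b'.
apply: le_trans (infsup_lbound f b) _.
apply: ge_ereal_sup => _ [a _ <-]; have [a' fga] := fgb a.
by apply: le_trans fga _; apply: ereal_sup_ubound; exists a'.
Qed.

Lemma infsup_leD (R : realType) (B A : Type) (f g : B -> A -> \bar R) (e : R) :
  (forall b a, f b a <= g b a + e%:E) -> infsup f <= infsup g + e%:E.
Proof.
move=> fg; rewrite -leeBlDr //; apply: le_ereal_inf_tmp => _ [b _ <-].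
rewrite leeBlDr //.
apply: le_trans (infsup_lbound f b) _.
apply: ge_ereal_sup => _ [a _ <-]; apply: le_trans (fg b a) _.
by apply: leeD2r; apply: ereal_sup_ubound; exists a.
Qed.

(** The points of [B] and [A] exclude empty ranges, whose infimum and supremum are infinite. *)
Lemma infsup_cst (R : realType) (B A : Type) (f : B -> A -> \bar R) c :
  B -> A -> (forall b a, f b a = c) -> infsup f = c.
Proof.
move=> b0 a0 fc; apply/le_anti/andP; split.
  apply: le_trans (infsup_lbound f b0) _.
  by apply: ge_ereal_sup => _ [a _ <-]; rewrite fc.
apply: le_ereal_inf_tmp => _ [b _ <-]; apply: ereal_sup_ubound.
by exists a0 => //; rewrite fc.
Qed.

Lemma infsup_pZl (R : realType) (B A : Type) (f : B -> A -> \bar R) (c : R) :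
  (0 < c)%R -> infsup (fun b a => c%:E * f b a) = c%:E * infsup f.
Proof.
move=> c0; rewrite /infsup -ereal_inf_pZl // image_comp; congr ereal_inf.
by apply: eq_imagel => b _ /=; rewrite -ereal_sup_pZl // image_comp.
Qed.

(** * The abstract game with a payoff on the draws *)

Section Value.
Variables (R : realType) (n : nat).
Local Notation stage := (mixed_gains R n * signal n)%type.
Local Notation history k := (law R n * k.-tuple stage)%type.

(* Strategies take the initial law as an argument; freezing it shows that the
   value of the abstract game below does not depend on that law. *)
Lemma measurable_freeze d (E : measurableType d) N (s : strategy R n E N)
    (m : law R n) (k : 'I_N) :
  measurable_fun [set: history k] (fun h => s k (m, h.2)).
Proof.
apply: (measurableT_comp (f := s k)) => //.
exact: measurable_fun_pair.
Qed.

Definition freeze d (E : measurableType d) N (s : strategy R n E N)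
    (m : law R n) : strategy R n E N :=
  fun k => mfun_of (measurable_freeze s m (k := k)).

Definition constant_strategy d (E : measurableType d) N (e : E) :
    strategy R n E N :=
  fun k => mfun_of (measurable_cst e).

Definition value N (m : law R n) (F : N.-tuple (draw n) -> R) : \bar R :=
  infsup (fun (beta : forecaster_strategy R n N)
              (alpha : adversary_strategy R n N) =>
    (expected m alpha beta F)%:E).

Lemma value_law N (m m' : law R n) (F : N.-tuple (draw n) -> R) :
  value m F = value m' F.
Proof.
suff le m1 m2 : value m1 F <= value m2 F by apply/le_anti; rewrite !le.
apply: le_infsup => beta; exists (freeze beta m2) => alpha.
exists (freeze alpha m1).
by rewrite lee_fin le_eqVlt; apply/orP; left; apply/eqP; exact: expected_ext.
Qed.

Lemma value_leD N (m : law R n) F (G : N.-tuple (draw n) -> R) (e : R) :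
  (forall w, F w <= G w + e)%R -> value m F <= value m G + e%:E.
Proof.
move=> FG; apply: infsup_leD => beta alpha.
by rewrite -EFinD lee_fin expected_le.
Qed.

Lemma value0 N (m : law R n) (F : N.-tuple (draw n) -> R) :
  (forall w, F w = 0%R) -> value m F = 0.
Proof.
move=> F0; apply: infsup_cst => [||beta alpha].
- exact: (constant_strategy (N := N) (point : mixed_expert R n)).
- exact: (constant_strategy (N := N) (point : mixed_gains R n)).
- by rewrite /expected big1 // => w _; rewrite F0 mulr0.
Qed.

Lemma valueZ N (m : law R n) (F : N.-tuple (draw n) -> R) (c : R) :
  (0 <= c)%R ->
  value m (fun w => c * F w)%R = c%:E * value m F.
Proof.
rewrite le_eqVlt => /predU1P[<-|c0].
  by rewrite mul0e value0 // => w; rewrite mul0r.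
rewrite -infsup_pZl //; congr infsup.
apply/funext => beta; apply/funext => alpha.
by rewrite expectedZ EFinM.
Qed.

(** Compares [F] with the zero payoff in both directions, with the sum of all [|F w|] as error. *)
Lemma value_fin_num N (m : law R n) (F : N.-tuple (draw n) -> R) :
  value m F \is a fin_num.
Proof.
pose c := (\sum_w `|F w|)%R.
have Fc w : (`|F w| <= c)%R.
  by rewrite /c (bigD1 w) //= lerDl sumr_ge0.
have up : value m F <= c%:E.
  rewrite -[c%:E]add0e -(@value0 N m (fun=> 0%R)) //; apply: value_leD => w.
  by rewrite add0r (le_trans (ler_norm _)).
have lo : - c%:E <= value m F.
  rewrite -sube_ge0 // oppeK -(@value0 N m (fun=> 0%R)) //.
  apply: value_leD => w.
  by have := Fc w; rewrite ler_norml => /andP[]; lra.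
by rewrite fin_real // (lt_le_trans _ lo) ?ltNyr//= (le_lt_trans up) ?ltry.
Qed.

(** The factor [hat a y] of the signal probability is already contained in [after]. *)
Definition stage_value N (m : law R n) (F : N.+1.-tuple (draw n) -> R)
    (b : mixed_expert R n) (a : mixed_gains R n) : \bar R :=
  \sum_y (mass b y.1)%:E * value m (after F a y).

Lemma stage_valueE N (m : law R n) (F : N.+1.-tuple (draw n) -> R) b a :
  stage_value m F b a =
  (\sum_y mass b y.1 * fine (value m (after F a y)))%R%:E.
Proof.
rewrite -sumEFin; apply: eq_bigr => y _.
by rewrite EFinM (fineK (value_fin_num m _)).
Qed.

Lemma measurable_signal (A : set (signal n)) : measurable A.
Proof.
rewrite (_ : A = \bigcup_(y in A) [set y]); last first.
  by apply/seteqP; split=> [y Ay|y [z Az ->]//]; exists y.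
apply: fin_bigcup_measurable => [|y _]; first exact: finite_finset.
rewrite (_ : [set y] = [set y.1] `*` [set y.2]); first exact: measurableX.
by case: y => i b; apply/seteqP; split=> [_ -> //|[i' b'] [/= -> ->]].
Qed.

Lemma measurable_last_signal (y : signal n) :
  measurable ((snd : stage -> signal n) @^-1` [set y]).
Proof.
rewrite -[X in measurable X]setTI.
have ms : measurable_fun [set: stage] snd by exact: measurable_snd.
exact: (ms measurableT _ (measurable_signal [set y])).
Qed.

(* Whatever the forecaster does, the adversary can play any a first and then
   answer optimally, up to a small error, after each of the finitely many
   signals. *)
Lemma value_ge_stage N (m : law R n) (F : N.+1.-tuple (draw n) -> R) :
  infsup (stage_value m F) <= value m F.
Proof.
apply: le_ereal_inf_tmp => _ [beta _ <-].
(* The infimum over [b] is tested at the first move that [beta] makes. *)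
apply: le_trans (infsup_lbound _ (beta ord0 (m, [tuple]))) _.
apply: ge_ereal_sup => _ [a _ <-]; apply/lee_addgt0Pr => e e0.
(* With [beta] and [a] fixed, [s y] is within [e / 2] of the value of the continuation after [y]. *)
have /choice[s hs] (y : signal n) : exists alpha : adversary_strategy R n N,
    (fine (value m (after F a y)) <=
     expected m alpha (continuation beta m (a, y)) (after F a y) + e / 2)%R.
  have : (fine (value m (after F a y)) - e / 2)%:E <
      ereal_sup (range (fun alpha =>
        (expected m alpha (continuation beta m (a, y)) (after F a y))%:E)).
    apply: (@lt_le_trans _ _ (value m (after F a y))).
      by rewrite -[ltRHS](fineK (value_fin_num m _)) lte_fin; lra.
    exact: (infsup_lbound _ (continuation beta m (a, y))).
  move=> /ereal_sup_gt[_ [alpha _ <-]]; rewrite lte_fin => lt.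
  by exists alpha; lra.
pose alpha := join_strategy measurable_last_signal a (fun=> m) s.
apply: (@le_trans _ _ ((expected m alpha beta F)%:E + e%:E)); last first.
  by apply: leeD2r; apply: ereal_sup_ubound; exists alpha.
rewrite stage_valueE -EFinD lee_fin (expectedS m (fun=> m)).
set b := beta ord0 _.
have -> : e = (\sum_(y : signal n) mass b y.1 * (e / 2))%R.
  by rewrite -big_distrl /= sum_signal_mass mulrC divfK // pnatr_eq0.
rewrite -big_split /=; apply: ler_sum => y _.
rewrite -mulrDr ler_wpM2l ?mass_ge0 //; apply: le_trans (hs y) _.
rewrite lerD2r le_eqVlt; apply/orP; left; apply/eqP/expected_ext => // k h.
by rewrite continuation_join.
Qed.

(** * A measurable grid on the mixed actions of the adversary *)

(** Index of the grid cube of side [1 / M] containing the vector of masses of [a]. *)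
Definition cell (M : nat) (a : mixed_gains R n) : {ffun {set 'I_n.+1} -> nat} :=
  [ffun j => Num.trunc (M%:R * mass a j)%R].

(** Relates real-valued masses to the sets that generate the sigma-algebra of [pprobability]. *)
Lemma mset_mass (j : {set 'I_n.+1}) (r : R) :
  mset [set j] r = [set a : mixed_gains R n | (mass a j < r)%R].
Proof.
by apply/seteqP; split=> a;
  rewrite /mset /mass /= -lte_fin fineK // fin_num_measure.
Qed.

Lemma measurable_mass_lt (j : {set 'I_n.+1}) (r : R) :
  measurable [set a : mixed_gains R n | (mass a j < r)%R].
Proof.
rewrite -mset_mass.
(* The generating sets have [r] between 0 and 1; beyond these bounds the set is empty or full. *)
have [r0|r0] := ltP r 0%R; first by rewrite lt0_mset.
have [r1|r1] := ltP 1%R r; first by rewrite gt1_mset.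
apply: sub_sigma_algebra; exists r; first by rewrite /= in_itv /= r0.
by exists [set j].
Qed.

Lemma mass_itv M (a : mixed_gains R n) j :
  ((Num.trunc (M%:R * mass a j))%:R <= M%:R * mass a j <
   (Num.trunc (M%:R * mass a j)).+1%:R)%R.
Proof. by apply: truncn_itv; rewrite mulr_ge0 // mass_ge0. Qed.

Lemma measurable_cell M f : measurable (cell M @^-1` [set f]).
Proof.
rewrite (_ : _ @^-1` _ = \bigcap_(j in [set: {set 'I_n.+1}])
   [set a : mixed_gains R n | Num.trunc (M%:R * mass a j)%R = f j]); last first.
  apply/seteqP; split=> [a <- j _|a af]; first by rewrite /= ffunE.
  by apply/ffunP => j; rewrite ffunE; exact: af.
apply: fin_bigcap_measurable => [|j _]; first exact: finite_finset.
case: M => [|M].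
  rewrite (_ : [set _ | _] = [set _ | 0%N = f j]); last first.
    by apply/seteqP; split=> a /=; rewrite mul0r truncn0.
  have [->|ne] := eqVneq 0%N (f j).
    by rewrite (_ : [set _ | _] = setT) //; apply/seteqP.
  rewrite (_ : [set _ | _] = set0) //; apply/seteqP; split => // a /= /eqP.
  by rewrite (negPf ne).
(* A truncation equals [f j] on a half-open interval of masses, which is a difference of two
   sublevel sets. *)
rewrite (_ : [set _ | _] =
  [set a : mixed_gains R n | mass a j < (f j).+1%:R / M.+1%:R]%R `\`
  [set a : mixed_gains R n | mass a j < (f j)%:R / M.+1%:R]%R); last first.
  apply/seteqP; split=> a /=; rewrite !ltr_pdivlMr // ![(mass a j * _)%R]mulrC.
    move=> <-; have /andP[l ->] := mass_itv M.+1 a j.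
    by split => //; apply/negP; rewrite -leNgt.
  move=> [u /negP]; rewrite -leNgt => l.
  by apply: truncn_def; rewrite l.
by apply: measurableD; exact: measurable_mass_lt.
Qed.

Lemma cell_close M a a' j : cell M.+1 a = cell M.+1 a' ->
  (`|mass a j - mass a' j| <= M.+1%:R^-1)%R.
Proof.
move=> /ffunP/(_ j); rewrite !ffunE.
have M0 : (0 < M.+1%:R :> R)%R by [].
have /andP[l u] := mass_itv M.+1 a j.
have /andP[l' u'] := mass_itv M.+1 a' j.
move=> e; rewrite e in l u.
rewrite -(ler_pM2l M0) divff ?gt_eqF // -[X in (X * `|_|)%R]gtr0_norm //.
rewrite -normrM mulrBr.
move: u u'; rewrite -!(natr1 (Num.trunc _)) => u u'.
by rewrite ler_norml; lra.
Qed.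

(** [after] is linear in the masses of [a] with coefficients bounded by [c], and at most all subsets
    contribute. *)
Lemma after_close N (F : N.+1.-tuple (draw n) -> R) (c d : R) a a' y w :
  (forall w, `|F w| <= c)%R -> (forall j, `|mass a j - mass a' j| <= d)%R ->
  (after F a y w <= after F a' y w + #|{set 'I_n.+1}|%:R * (d * c))%R.
Proof.
move=> Fc ad; rewrite -lerBlDl /after -sumrB.
have d0 : (0 <= d)%R by exact: le_trans (ad finset.set0).
have c0 : (0 <= c)%R.
  exact: le_trans (Fc [tuple of (ord0, finset.set0) :: w]).
apply: (@le_trans _ _ (\sum_(j | compatible y j) d * c)%R).
  apply: ler_sum => j _; rewrite -mulrBl (le_trans (ler_norm _)) // normrM.
  by rewrite ler_pM.
rewrite sumr_const -[(_ *+ _)%R]mulr_natl ler_wpM2r ?mulr_ge0 // ler_nat.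
exact: max_card.
Qed.

(* A continuation that is good for one point of a cell is good up to a small
   error for all of them, which replaces a measurable selection. *)
Lemma value_le_stage N (m : law R n) (F : N.+1.-tuple (draw n) -> R) :
  value m F <= infsup (stage_value m F).
Proof.
apply: le_ereal_inf_tmp => _ [b _ <-]; apply/lee_addgt0Pr => e e0.
pose c := (\sum_w `|F w| + 1)%R.
have Fc w : (`|F w| <= c)%R.
  by rewrite /c (bigD1 w) //= -addrA lerDl addr_ge0 // sumr_ge0.
pose C := (#|{set 'I_n.+1}|%:R * c)%R.
(* Three errors [e'] will occur per signal, and the signal masses sum to 2. The mesh [dl] is chosen
   so that [after] varies by at most [e'] on a cell. *)
pose e' := (e / 6)%R; have e'0 : (0 < e')%R by rewrite divr_gt0.
pose M := Num.trunc (C / e')%R; pose dl := (M.+1%:R^-1 : R)%R.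
have dlC : (#|{set 'I_n.+1}|%:R * (dl * c) <= e')%R.
  rewrite mulrCA -/C mulrC ler_pdivrMr // mulrC -ler_pdivrMr //.
  have C0 : (0 <= C / e')%R.
    by rewrite divr_ge0 ?(ltW e'0) // mulr_ge0 // addr_ge0 // sumr_ge0.
  by have /andP[_ /ltW] := truncn_itv C0.
have near a a' y : cell M.+1 a = cell M.+1 a' ->
    forall w : N.-tuple (draw n), (after F a y w <= after F a' y w + e')%R.
  move=> aa' w; have close j := cell_close j aa'.
  by apply: le_trans (after_close y w Fc close) _; rewrite lerD2l.
(* One representative per nonempty cell; [point] is a default value on empty cells. *)
have /choice[rep hrep] (f : {ffun {set 'I_n.+1} -> nat}) : exists a',
    (exists a, cell M.+1 a = f) -> cell M.+1 a' = f.
  have [[a <-]|nf] := pselect (exists a, cell M.+1 a = f); first by exists a.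
  by exists point => /nf.
(* A forecaster strategy that is [e']-optimal at the representative of the cell, for each signal. *)
have /choice[s hs] (x : {ffun {set 'I_n.+1} -> nat} * signal n) :
    exists beta : forecaster_strategy R n N,
    forall alpha : adversary_strategy R n N,
    (expected m alpha beta (after F (rep x.1) x.2) <=
     fine (value m (after F (rep x.1) x.2)) + e')%R.
  have : value m (after F (rep x.1) x.2) <
      (fine (value m (after F (rep x.1) x.2)) + e')%:E.
    rewrite EFinD (fineK (value_fin_num _ _)).
    by rewrite lteDl ?lte_fin // value_fin_num.
  move=> /ereal_inf_lt[_ [beta _ <-]] lt; exists beta => alpha.
  rewrite -lee_fin; apply: le_trans (ltW lt).
  by apply: ereal_sup_ubound; exists alpha.
pose cl (x : stage) := (cell M.+1 x.1, x.2).
have mcl i : measurable (cl @^-1` [set i]).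
  rewrite (_ : _ @^-1` _ = (cell M.+1 @^-1` [set i.1]) `*` [set i.2]).
    by apply: measurableX; [exact: measurable_cell|exact: measurable_signal].
  by case: i => f y; apply/seteqP; split=> [[a z] [<- <-] //|[a z] [/= <- <-]].
pose beta := join_strategy mcl b (fun=> m) s.
apply: le_trans (infsup_lbound _ beta) _.
apply: ge_ereal_sup => _ [alpha _ <-].
set a := alpha ord0 (m, [tuple]).
apply: (@le_trans _ _ (stage_value m F b a + e%:E)); last first.
  by apply: leeD2r; apply: ereal_sup_ubound; exists a.
rewrite stage_valueE -EFinD lee_fin (expectedS m (fun=> m)).
have -> : e = (\sum_(y : signal n) mass b y.1 * (e / 2))%R.
  by rewrite -big_distrl /= sum_signal_mass mulrC divfK // pnatr_eq0.
rewrite -big_split /=; apply: ler_sum => y _.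
rewrite -mulrDr ler_wpM2l ?mass_ge0 // -/a.
have ca : cell M.+1 (rep (cell M.+1 a)) = cell M.+1 a by apply: hrep; exists a.
set alpha' := continuation alpha m (a, y).
(* Pass from [a] to the representative of its cell, use near-optimality there, and return to [a] in
   the value. *)
have h1 := expected_le m alpha' (s (cl (a, y))) (near _ _ y (esym ca)).
have h2 := hs (cl (a, y)) alpha'.
have h3 : (fine (value m (after F (rep (cell M.+1 a)) y)) <=
    fine (value m (after F a y)) + e')%R.
  rewrite -lee_fin EFinD !(fineK (value_fin_num _ _)).
  exact: value_leD (near _ _ y ca).
have -> : expected m alpha' (continuation beta m (a, y)) (after F a y) =
    expected m alpha' (s (cl (a, y))) (after F a y).
  by apply: expected_ext => // k h; rewrite continuation_join.
rewrite /= in h2; have : (e / 2 = e' + e' + e')%R by rewrite /e'; lra.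
lra.
Qed.

Lemma value_stage N (m : law R n) (F : N.+1.-tuple (draw n) -> R) :
  value m F = infsup (stage_value m F).
Proof. by apply/le_anti; rewrite value_le_stage value_ge_stage. Qed.

End Value.

(** * The maximal coordinate under translations of the state *)

Section MaxCoord.
Variables (R : realType) (n : nat).
Local Notation state := 'rV[R]_n.+1.

Lemma measurable_coord (i : 'I_n.+1) :
  measurable_fun [set: state] (fun x : state => x ord0 i).
Proof.
apply: (measurability _ (RGenOpens.measurableE R)) => // _ [_ [a [b ->] <-]].
rewrite setTI; apply: sub_sigma_algebra.
have /continuousP := @coord_continuous R 1 n.+1 ord0 i; apply.
exact: interval_open.
Qed.

Lemma measurable_max_coord : measurable_fun [set: state] (@max_coord R n).
Proof.
rewrite /max_coord; elim: (index_enum _) => [|i r IH].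
  by under eq_fun do rewrite big_nil; exact: measurable_coord.
under eq_fun do rewrite big_cons.
by apply: measurable_maxr => //; exact: measurable_coord.
Qed.

(** No coordinate moves by more than the right-hand side. The bound does not depend on [x], so
    translations preserve integrability. *)
Lemma max_coordD (x v : state) :
  (`|max_coord (x + v)%R - max_coord x| <= \sum_i `|v ord0 i|)%R.
Proof.
set c := (\sum_i _)%R.
have vc i : (`|v ord0 i| <= c)%R by rewrite /c (bigD1 i) //= lerDl sumr_ge0.
have coordle (z : state) i : (z ord0 i <= max_coord z)%R by exact: le_bigmax.
have vle i : (- c <= v ord0 i <= c)%R by rewrite -ler_norml.
rewrite ler_distl; apply/andP; split.
  rewrite lerBlDr; apply/bigmax_leP; split=> [|i _].
    by have := coordle (x + v)%R ord0; have /andP[] := vle ord0; rewrite mxE; lra.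
  by have := coordle (x + v)%R i; have /andP[] := vle i; rewrite mxE; lra.
apply/bigmax_leP; split=> [|i _].
  by have := coordle x ord0; have /andP[] := vle ord0; rewrite mxE; lra.
by have := coordle x i; have /andP[] := vle i; rewrite mxE; lra.
Qed.

(** Each round translates the state by a vector that depends on the draw alone. *)
Lemma final_stateE N (x : state) (w : N.-tuple (draw n)) :
  final_state x w = (x + final_state (0 : state) w)%R.
Proof.
rewrite /final_state; elim: (tval w) x => [|d l IH] x /=.
  by rewrite addr0.
rewrite IH [in RHS]IH addrA; congr (_ + _)%R.
by rewrite /next_state add0r addrA.
Qed.

(** On a correct guess $e_j - e = -e_{j^c}$; otherwise only $e_j$ is added. *)
Lemma next_state_signal (x : state) (y : signal n) (j : {set 'I_n.+1}) :
  compatible y j -> next_state x (y.1, j) = (x + signal_shift R y j)%R.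
Proof.
case: y => i b; rewrite /compatible /next_state /signal_shift /= => /eqP ->.
rewrite -addrA; congr (_ + _)%R.
case: b; rewrite ?scale0r ?subr0 // scale1r; apply/rowP => k.
by rewrite !mxE !inE; case: (k \in j); rewrite /= ?subrr ?oppr0 ?sub0r.
Qed.

End MaxCoord.

(** * Finiteness of integrals under bounded perturbations *)

Section Integral.
Local Open Scope ereal_scope.
Context d (T : measurableType d) (R : realType).

Lemma integral_lty_leD (mu : probability T R) (f g : T -> R) (c : R) :
  measurable_fun setT f -> measurable_fun setT g -> (0 <= c)%R ->
  (forall x, 0 <= f x)%R -> (forall x, 0 <= g x)%R ->
  (forall x, f x <= g x + c)%R ->
  \int[mu]_x (g x)%:E < +oo -> \int[mu]_x (f x)%:E < +oo.
Proof.
move=> mf mg c0 f0 g0 fg gfin.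
apply: (@le_lt_trans _ _ (\int[mu]_x ((g x)%:E + c%:E))).
  apply: ge0_le_integral => //.
  - by move=> x _; rewrite lee_fin.
  - exact/measurable_EFinP.
  - by apply: emeasurable_funD; [exact/measurable_EFinP|exact: measurable_cst].
  - by move=> x _; rewrite -EFinD lee_fin.
have -> : \int[mu]_x ((g x)%:E + c%:E) = \int[mu]_x (g x)%:E + c%:E.
  rewrite ge0_integralD //.
  - by rewrite integral_cst //= probability_setT mule1.
  - by move=> x _; rewrite lee_fin.
  - exact/measurable_EFinP.
by rewrite lte_add_pinfty // ltry.
Qed.

End Integral.

(** * Nonnegative integrals against an updated belief *)

Section Belief.
Local Open Scope ereal_scope.
Variables (R : realType) (n : nat).
Local Notation state := 'rV[R]_n.+1.
Variables (m : law R n) (a : mixed_gains R n) (y : signal n).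

Definition translated (v : state) : measure state R :=
  measure_function_pushforward__canonical__measure_function_Measure
    (m : probability _ R) (measurable_translation v).

Lemma ge0_integral_belief_update (h : state -> \bar R) :
  hat a y != 0%R -> measurable_fun setT h -> (forall x, 0 <= h x) ->
  \int[belief_update m a y]_x h x =
  \sum_(j | compatible y j) (mass a j / hat a y)%:E *
    \int[m : probability _ R]_x h (x + signal_shift R y j)%R.
Proof.
move=> hat0 mh h0.
(* [msum] is indexed by naturals, so the compatible subsets are listed to write the update as a
   finite sum of scaled pushforwards. *)
pose l := enum (compatible y).
have w0 k : (0 <= mass a (nth finset.set0 l k) / hat a y)%R.
  by rewrite divr_ge0 ?mass_ge0 ?hat_ge0.
pose mk k : measure state R :=
  mscale (NngNum (w0 k)) (translated (signal_shift R y (nth finset.set0 l k))).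
rewrite (eq_measure_integral (msum mk (size l))); last first.
  move=> A mA _; rewrite /= /belief_update (negPf hat0) /msum /=.
  by rewrite -big_enum (big_nth finset.set0) big_mkord.
rewrite ge0_integral_measure_sum //.
rewrite -[RHS]big_enum [RHS](big_nth finset.set0) big_mkord.
apply: eq_bigr => k _; rewrite /mk ge0_integral_mscale //; congr (_ * _).
rewrite ge0_integral_pushforward //; exact: measurable_translation.
Qed.

End Belief.

(** * Positive and negative parts, and infinite integrals *)

Section Parts.
Context d (T : measurableType d) (R : realType).
Implicit Types (mu : probability T R) (f g : T -> R).

(** The negative part of [f] is reached as [int_pos] of [- f], so one argument serves both parts. *)
Definition int_pos mu f : \bar R := \int[mu]_x (Num.max (f x) 0)%:E.

Lemma int_pos_ge0 mu f : 0 <= int_pos mu f.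
Proof. by apply: integral_ge0 => x _; rewrite lee_fin le_max lexx orbT. Qed.

Lemma integral_parts mu f :
  \int[mu]_x (f x)%:E = int_pos mu f - int_pos mu (fun x => - f x)%R.
Proof.
rewrite integralE; congr (_ - _); apply: eq_integral => x _.
  by rewrite funeposE EFin_max.
by rewrite funenegE EFin_max.
Qed.

Lemma sub_fin_num (p q : \bar R) : 0 <= p -> 0 <= q ->
  (p - q \is a fin_num) = (p < +oo) && (q < +oo).
Proof. by move: p q => [p| |] [q| |] //=; rewrite !ltry. Qed.

(** For [p], [q] the two parts of one integral and [p'], [q'] those of another: if corresponding
    parts are finite together, the integrals are both finite or the same infinity, including
    [+oo - +oo = -oo]. *)
Lemma same_infinities (p q p' q' : \bar R) :
  0 <= p -> 0 <= q -> 0 <= p' -> 0 <= q' ->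
  (p < +oo) = (p' < +oo) -> (q < +oo) = (q' < +oo) ->
  (p - q \is a fin_num) = (p' - q' \is a fin_num) /\
  (p - q \isn't a fin_num -> p' - q' = p - q).
Proof.
by move: p q p' q' => [p| |] [q| |] [p'| |] [q'| |] //=; rewrite !ltry.
Qed.

Lemma int_pos_lty_le mu f g (c : R) :
  measurable_fun setT f -> measurable_fun setT g -> (0 <= c)%R ->
  (forall x, f x <= g x + c)%R -> int_pos mu g < +oo -> int_pos mu f < +oo.
Proof.
move=> mf mg c0 fg; apply: (@integral_lty_leD _ _ _ _ _ _ c) => //.
- by apply: measurable_maxr => //; exact: measurable_cst.
- by apply: measurable_maxr => //; exact: measurable_cst.
- by move=> x; rewrite le_max lexx orbT.
- by move=> x; rewrite le_max lexx orbT.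
- move=> x; rewrite ge_max; apply/andP; split.
    by apply: le_trans (fg x) _; rewrite lerD2r le_max lexx.
  by rewrite addr_ge0 // le_max lexx orbT.
Qed.

Lemma int_pos_lty mu f g (c : R) :
  measurable_fun setT f -> measurable_fun setT g ->
  (forall x, `|f x - g x| <= c)%R ->
  (int_pos mu f < +oo) = (int_pos mu g < +oo).
Proof.
move=> mf mg fg.
have c0 : (0 <= c)%R by exact: le_trans (fg point).
apply/idP/idP; apply: (@int_pos_lty_le _ _ _ c) => // x;
  have := fg x; rewrite ler_norml => /andP[]; lra.
Qed.

Lemma integral_bounded_distance mu f g (c : R) :
  measurable_fun setT f -> measurable_fun setT g ->
  (forall x, `|f x - g x| <= c)%R ->
  (\int[mu]_x (f x)%:E \is a fin_num) =
    (\int[mu]_x (g x)%:E \is a fin_num) /\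
  (\int[mu]_x (f x)%:E \isn't a fin_num ->
   \int[mu]_x (g x)%:E = \int[mu]_x (f x)%:E).
Proof.
move=> mf mg fg; rewrite !integral_parts.
apply: same_infinities; try exact: int_pos_ge0.
  exact: (@int_pos_lty _ _ _ c).
apply: (@int_pos_lty _ _ _ c); try exact: measurableT_comp.
by move=> x; rewrite opprK addrC distrC.
Qed.

End Parts.

(** * Signed integrals against an updated belief *)

Section BeliefIntegral.
Variables (R : realType) (n : nat).
Local Notation state := 'rV[R]_n.+1.
Variables (m : law R n) (a : mixed_gains R n) (y : signal n).
Hypothesis hat0 : hat a y != 0%R.
Let l : probability _ R := belief_update m a y.
Let weight j := (mass a j / hat a y)%R.

Let hat_gt0 : (0 < hat a y)%R.
Proof. by rewrite lt_neqAle eq_sym hat0 hat_ge0. Qed.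

Let weight_ge0 j : (0 <= weight j)%R.
Proof. by rewrite divr_ge0 ?mass_ge0 // ltW. Qed.

Lemma measurable_shift (v : state) (f : state -> R) : measurable_fun setT f ->
  measurable_fun setT (fun x : state => f (x + v)%R).
Proof.
by move=> mf; apply: (measurableT_comp mf); exact: measurable_translation.
Qed.

Lemma int_pos_belief_update (f : state -> R) : measurable_fun setT f ->
  int_pos l f = \sum_(j | compatible y j) (weight j)%:E *
    int_pos (m : probability _ R)
      (fun x : state => f (x + signal_shift R y j)%R).
Proof.
move=> mf; apply: (@ge0_integral_belief_update _ _ m a y
  (fun x : state => (Num.max (f x) 0)%:E)) => //.
  by apply/measurable_EFinP/measurable_maxr => //; exact: measurable_cst.
by move=> x; rewrite lee_fin le_max lexx orbT.
Qed.

(** Finite translated integrals have finite parts, so the difference of the two weighted sums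
    regroups term by term in the reals. *)
Lemma integral_belief_update (f : state -> R) : measurable_fun setT f ->
  (forall v : state,
    \int[m : probability _ R]_x (f ((x : state) + v)%R)%:E \is a fin_num) ->
  \int[l]_x (f x)%:E = \sum_(j | compatible y j) (weight j)%:E *
    \int[m : probability _ R]_x (f ((x : state) + signal_shift R y j)%R)%:E.
Proof.
move=> mf fin; rewrite integral_parts !int_pos_belief_update //; last first.
  exact: measurableT_comp.
pose P v := int_pos (m : probability _ R) (fun x : state => f (x + v)%R).
pose Q v := int_pos (m : probability _ R) (fun x : state => - f (x + v))%R.
have PQ v :
    \int[m : probability _ R]_x (f ((x : state) + v)%R)%:E = P v - Q v.
  exact: integral_parts.
have /all_and2[finP finQ] v : P v \is a fin_num /\ Q v \is a fin_num.
  have := fin v; rewrite PQ sub_fin_num ?int_pos_ge0 // => /andP[p q].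
  by rewrite !ge0_fin_numE ?int_pos_ge0.
pose s := signal_shift R y.
transitivity (\sum_(j | compatible y j) (weight j * fine (P (s j)))%:E -
              \sum_(j | compatible y j) (weight j * fine (Q (s j)))%:E).
  by congr (_ - _); apply: eq_bigr => j _;
    rewrite [RHS]EFinM ?(fineK (finP _)) ?(fineK (finQ _)).
rewrite !sumEFin -EFinB -sumrB -sumEFin; apply: eq_bigr => j _.
by rewrite PQ -mulrBr [LHS]EFinM EFinB (fineK (finP _)) (fineK (finQ _)).
Qed.

(** By the bound [c], each translated integral is finite exactly when that of [f] is. Since
    [hat a y != 0], some compatible [j] has positive mass, so an infinite term survives its
    weight. *)
Lemma int_pos_belief_update_lty (f : state -> R) (c : state -> R) :
  measurable_fun setT f -> (forall v x : state, `|f (x + v) - f x| <= c v)%R ->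
  (int_pos l f < +oo) = (int_pos (m : probability _ R) f < +oo).
Proof.
move=> mf fc.
have shift v :
    (int_pos (m : probability _ R) (fun x : state => f (x + v)%R) < +oo) =
    (int_pos (m : probability _ R) f < +oo).
  by apply: int_pos_lty (fc v) => //; exact: measurable_shift.
rewrite int_pos_belief_update //; apply/idP/idP => [|fin]; last first.
  apply: lte_sum_pinfty => j _; apply: lte_mul_pinfty; rewrite ?lee_fin //.
  by rewrite shift.
have /existsP[j /andP[yj aj]] : [exists j, compatible y j && (mass a j != 0%R)].
  apply: contraNT hat0; rewrite negb_exists => /forallP a0; apply/eqP.
  by apply: big1 => j yj; have := a0 j; rewrite yj negbK => /eqP.
move=> fin; rewrite -(shift (signal_shift R y j)).
have : (weight j)%:E * int_pos (m : probability _ R)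
    (fun x : state => f (x + signal_shift R y j)%R) < +oo.
  apply: le_lt_trans fin; rewrite (bigD1 j) //= leeDl // sume_ge0 // => k _.
  by rewrite mule_ge0 ?lee_fin // int_pos_ge0.
apply: contraTT; rewrite -!leNgt !leye_eq => /eqP ->.
rewrite gt0_muley // lte_fin divr_gt0 // lt_neqAle eq_sym aj; exact: mass_ge0.
Qed.

Lemma integral_belief_update_infinite (f : state -> R) (c : state -> R) :
  measurable_fun setT f -> (forall v x : state, `|f (x + v) - f x| <= c v)%R ->
  (\int[m : probability _ R]_x (f x)%:E \is a fin_num) =
    (\int[l]_x (f x)%:E \is a fin_num) /\
  (\int[m : probability _ R]_x (f x)%:E \isn't a fin_num ->
   \int[l]_x (f x)%:E = \int[m : probability _ R]_x (f x)%:E).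
Proof.
move=> mf fc; rewrite !integral_parts.
apply: same_infinities; try exact: int_pos_ge0.
  by rewrite (int_pos_belief_update_lty mf fc).
rewrite (@int_pos_belief_update_lty (fun x : state => - f x)%R c) //.
  exact: measurableT_comp.
by move=> v x; rewrite opprK addrC distrC.
Qed.

End BeliefIntegral.

(** * From the abstract game to the game on beliefs *)

Section Rounds.
Variables (R : realType) (n : nat).
Local Notation state := 'rV[R]_n.+1.
Implicit Types m : law R n.

Definition mean_max m : \bar R := \int[m : probability _ R]_x (max_coord x)%:E.

(** [payoff] indexed by the number of rounds, with the forecaster first to fit [infsup]. *)
Definition rounds_payoff N m (beta : forecaster_strategy R n N)
    (alpha : adversary_strategy R n N) : \bar R :=
  \int[m : probability _ R]_x
    (\sum_w draws_prob m alpha beta w * max_coord (final_state x w))%R%:E.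

Definition rounds_value N m : \bar R := infsup (@rounds_payoff N m).

Definition mean_final N m (w : N.-tuple (draw n)) : R :=
  fine (\int[m : probability _ R]_x (max_coord (final_state x w))%:E).

Lemma measurable_final N (w : N.-tuple (draw n)) :
  measurable_fun setT (fun x : state => max_coord (final_state x w)).
Proof.
under eq_fun do rewrite final_stateE.
by apply: measurable_shift; exact: measurable_max_coord.
Qed.

Lemma max_coord_final N (w : N.-tuple (draw n)) (x : state) :
  (`|max_coord x - max_coord (final_state x w)| <=
   \sum_i `|final_state (0 : state) w ord0 i|)%R.
Proof. by rewrite distrC final_stateE; exact: max_coordD. Qed.

Lemma final_fin_num N m (w : N.-tuple (draw n)) : mean_max m \is a fin_num ->
  \int[m : probability _ R]_x (max_coord (final_state x w))%:E \is a fin_num.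
Proof.
rewrite /mean_max (integral_bounded_distance m (@measurable_max_coord R n)
  (measurable_final w) (max_coord_final w)).1.
by [].
Qed.

Lemma rounds_payoff_integrable N m beta (alpha : adversary_strategy R n N) :
  mean_max m \is a fin_num ->
  rounds_payoff m beta alpha = (expected m alpha beta (mean_final m))%:E.
Proof.
move=> fin.
have int w : (m : probability _ R).-integrable setT
    (fun x : state => (max_coord (final_state x w))%:E).
  apply/integrableP; split.
    by apply/measurable_EFinP; exact: measurable_final.
  rewrite integral_fin_num_abs //; first exact: final_fin_num.
  exact: measurable_final.
rewrite /rounds_payoff.
under eq_integral do rewrite -sumEFin.
rewrite integral_sum //.
  rewrite -sumEFin; apply: eq_bigr => w _.
  under eq_integral do rewrite EFinM.
  rewrite integralZl // [RHS]EFinM /mean_final fineK //; exact: final_fin_num.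
move=> w; under eq_fun do rewrite EFinM.
exact: integrableZl.
Qed.

(** The integrand averages translates of [max_coord], hence stays at bounded distance from it. *)
Lemma rounds_payoff_infinite N m beta (alpha : adversary_strategy R n N) :
  mean_max m \isn't a fin_num -> rounds_payoff m beta alpha = mean_max m.
Proof.
pose g (x : state) :=
  (\sum_w draws_prob m alpha beta w * max_coord (final_state x w))%R.
pose c :=
  (\sum_(w : N.-tuple (draw n)) \sum_i `|final_state (0 : state) w ord0 i|)%R.
apply: (integral_bounded_distance (g := g) (c := c) m
  (@measurable_max_coord R n) _ _).2.
  apply: measurable_sum => w; apply: measurable_funM => //.
  exact: measurable_final.
move=> x; rewrite /g -[max_coord x]mul1r -(sum_draws_prob m alpha beta).
rewrite big_distrl /= -sumrB (le_trans (ler_norm_sum _ _ _)) //.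
apply: ler_sum => w _; rewrite -mulrBr normrM.
apply: le_trans (max_coord_final w x).
rewrite -[leRHS]mul1r ler_wpM2r // ger0_norm ?draws_prob_ge0 //.
rewrite -(sum_draws_prob m alpha beta) (bigD1 w) //= lerDl sumr_ge0 // => v _.
exact: draws_prob_ge0.
Qed.

Lemma rounds_value_integrable N m : mean_max m \is a fin_num ->
  rounds_value N m = value m (@mean_final N m).
Proof.
move=> fin; congr infsup; apply/funext => beta; apply/funext => alpha.
exact: rounds_payoff_integrable.
Qed.

Lemma rounds_value_infinite N m : mean_max m \isn't a fin_num ->
  rounds_value N m = mean_max m.
Proof.
move=> inf.
apply: infsup_cst => [||beta alpha]; last exact: rounds_payoff_infinite.
- exact: (@constant_strategy R n _ (mixed_expert R n) N point).
- exact: (@constant_strategy R n _ (mixed_gains R n) N point).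
Qed.

Section Update.
Variables (m : law R n) (a : mixed_gains R n) (y : signal n).
Let l : law R n := (belief_update m a y : probability _ R).

Lemma mean_max_update : hat a y != 0%R ->
  (mean_max m \is a fin_num) = (mean_max l \is a fin_num) /\
  (mean_max m \isn't a fin_num -> mean_max l = mean_max m).
Proof.
move=> hat0; apply: (integral_belief_update_infinite m hat0
  (c := fun v : state => (\sum_i `|v ord0 i|)%R) (@measurable_max_coord R n)).
by move=> v x; exact: max_coordD.
Qed.

(** The factor [hat a y] cancels the normalisation of the belief, and each shift in the update is
    the first transition of the state. *)
Lemma hat_mean_final N (w : N.-tuple (draw n)) :
  mean_max m \is a fin_num -> hat a y != 0%R ->
  (hat a y * mean_final l w = after (mean_final m) a y w)%R.
Proof.
move=> fin hat0.
have finv (v : state) : \int[m : probability _ R]_x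
    (max_coord (final_state ((x : state) + v)%R w))%:E \is a fin_num.
  pose c := (\sum_i `|(v + final_state (0 : state) w)%R ord0 i|)%R.
  rewrite /mean_max in fin.
  rewrite -(integral_bounded_distance (c := c) m (@measurable_max_coord R n)
    (measurable_shift v (measurable_final w)) _).1 //.
  by move=> x; rewrite distrC final_stateE -addrA; exact: max_coordD.
rewrite /mean_final (integral_belief_update hat0 (measurable_final w) finv) /after.
under eq_bigr do rewrite -(fineK (finv _)) -EFinM.
rewrite sumEFin /= big_distrr /=; apply: eq_bigr => j yj.
rewrite mulrA mulrCA divff // mulr1; congr (_ * fine _)%R.
by apply: eq_integral => x _; rewrite -(next_state_signal x yj).
Qed.

Lemma hat_rounds_value N : mean_max m \is a fin_num ->
  (hat a y)%:E * rounds_value N l = value m (after (@mean_final N.+1 m) a y).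
Proof.
move=> fin; have [hat0|hat0] := eqVneq (hat a y) 0%R.
  (* A signal of probability 0 forces all compatible masses to vanish, so [after] is zero whatever
     the conventional belief is. *)
  rewrite hat0 mul0e value0 // => w; apply: big1 => j yj.
  have /eqP := hat0; rewrite psumr_eq0 => [/allP/(_ j)|k _]; last exact: mass_ge0.
  by rewrite mem_index_enum yj => /(_ isT)/eqP ->; rewrite mul0r.
have finl : mean_max l \is a fin_num by rewrite -(mean_max_update hat0).1.
rewrite rounds_value_integrable // (value_law l m) -valueZ; last first.
  exact: hat_ge0.
by congr value; apply/funext => w; exact: hat_mean_final.
Qed.

End Update.

Lemma rounds_valueS N m :
  rounds_value N.+1 m =
  infsup (fun (b : mixed_expert R n) (a : mixed_gains R n) =>
    \sum_(y : signal n) (mass b y.1 * hat a y)%:E *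
      rounds_value N (belief_update m a y : probability _ R)).
Proof.
have [fin|inf] := boolP (mean_max m \is a fin_num).
  rewrite rounds_value_integrable // value_stage; congr infsup.
  apply/funext => b; apply/funext => a; apply: eq_bigr => y _.
  by rewrite EFinM -muleA hat_rounds_value.
rewrite rounds_value_infinite //.
apply/esym/infsup_cst => [||b a]; try exact: point.
(* Every signal with nonzero [hat a y] leads to the same infinite value, the others have weight 0,
   and the signal probabilities sum to 1. *)
transitivity (\sum_(y : signal n) (mass b y.1 * hat a y)%:E * mean_max m).
  apply: eq_bigr => y _; have [->|hat0] := eqVneq (hat a y) 0%R.
    by rewrite mulr0 !mul0e.
  have [e h] := mean_max_update m hat0.
  by rewrite rounds_value_infinite -?e // h.
rewrite -ge0_sume_distrl => [|y _]; last first.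
  by rewrite lee_fin mulr_ge0 ?mass_ge0 ?hat_ge0.
by rewrite sumEFin sum_hat mul1e.
Qed.

End Rounds.

Theorem theorem2p1 (R : realType) (n : nat) (hK : (2 <= n.+1)%N)
    (T t : nat) (ht : (t < T)%N) (m : law R n) :
  game_value T t m =
  ereal_inf (range (fun b : mixed_expert R n =>
    ereal_sup (range (fun a : mixed_gains R n =>
      \sum_(i < n.+1) (mass b i * hat a (i, true))%:E *
        game_value T t.+1 (belief_update m a (i, true) : probability _ R) +
      \sum_(i < n.+1) (mass b i * hat a (i, false))%:E *
        game_value T t.+1 (belief_update m a (i, false) : probability _ R))))).
Proof.
(* [T - t] is the successor of [T - t.+1], which exposes the first round. *)
rewrite -[LHS]/(rounds_value (T - t) m) -(subnSK ht) rounds_valueS.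
congr infsup; apply/funext => b; apply/funext => a.
rewrite sum_pair -big_split /=; apply: eq_bigr => i _.
by rewrite big_bool.
Qed.
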